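(* Let $N\ge2$ be an integer and let the gain mismatches $g_0,\dots,g_{N-1}$ be i.i.d. real $\mathcal{N}(0,\sigma_{\mathbf{g}}^2)$ random variables with $\sigma_{\mathbf{g}}>0$. Let $P^{\mathrm{g}}_k=|\tilde g_k|^2$ be the power, relative to the input signal power, of the replica associated with DFT bin $k$. Then, for all $p\ge0$: (i) if $N$ is even, $$\Pr\left(P^{\mathrm{g}}_{N/2}\le p\right)=\operatorname{erf}\left(\sqrt{\frac{Np}{2\sigma_{\mathbf{g}}^2}}\right);$$ (ii) for every integer $k$ with $0<k<N/2$, $$\Pr\left(P^{\mathrm{g}}_k\le p\right)=1-e^{-\frac{Np}{\sigma_{\mathbf{g}}^2}}.$$
   Context: The normalized DFT of $\mathbf{g}$ is $\tilde g_k=\frac1N\sum_{n=0}^{N-1}e^{-2\pi j kn/N}g_n$, $k=0,\dots,N-1$, with $j$ the imaginary unit. In an $N$-fold interleaved ADC with relative gain mismatches $g_n$, the output spectrum contains replicas of the input spectrum shifted by $kf_s/N$ and scaled by $\tilde g_k$, so that the replica-to-input power ratio is $|\tilde g_k|^2$; the bin $k=0$ is disregarded. $\mathcal{N}(0,\sigma^2)$ is the zero-mean real Gaussian distribution of variance $\sigma^2$, and $\operatorname{erf}(x)=\frac{2}{\sqrt\pi}\int_0^x e^{-u^2}du$. *)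

(* Defs.v *)
From HB Require Import structures.
From mathcomp Require Export all_boot all_order all_algebra.
From mathcomp Require Export all_classical all_reals all_analysis.
From mathcomp Require Export complex.

Set Implicit Arguments.
Unset Strict Implicit.
Unset Printing Implicit Defensive.

Import Order.TTheory GRing.Theory Num.Theory.
Import numFieldNormedType.Exports.

Local Open Scope classical_set_scope.
Local Open Scope ring_scope.

Definition cexp (R : realType) (z : R[i]) : R[i] :=
  ((expR (complex.Re z))%:C * (cos (complex.Im z) +i* sin (complex.Im z)))%C.

Definition dft (R : realType) (N : nat) (x : 'I_N -> R[i]) (k : nat) : R[i] :=
  N%:R^-1 *
  \sum_(n < N) cexp (0 -i* (2 * pi * (k%:R * n%:R) / N%:R))%C * x n.

Definition gain_replica_power (R : realType) (N : nat) (g : 'I_N -> R)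
    (k : nat) : R :=
  (complex.Re `|dft (fun n => (g n)%:C%C) k|) ^+ 2.

(* [gauss_fun u] is e^(-u^2); the second branch is the oriented integral from 0
   to a negative [x]. *)
Definition erf (R : realType) (x : R) : R :=
  2 / Num.sqrt pi *
  (if 0 <= x then \int[lebesgue_measure]_(u in `[0, x]) gauss_fun u
   else - \int[lebesgue_measure]_(u in `[x, 0]) gauss_fun u).

Definition mutually_independent d (T : measurableType d) (R : realType)
    (P : probability T R) (I : finType) (X : I -> {RV P >-> R}) : Prop :=
  forall (J : {set I}) (A : I -> set R), (forall i, measurable (A i)) ->
    P (\bigcap_(i in [set` J]) (X i @^-1` A i)) =
    (\prod_(i in J) P (X i @^-1` A i))%E.

(* The laws are compared on measurable sets only, because a measure is a function
   on all sets whose values off the sigma-algebra are unconstrained. The second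
   argument of [normal_prob] is the standard deviation, not the variance. *)
Definition iid_centered_normal d (T : measurableType d) (R : realType)
    (P : probability T R) (I : finType) (X : I -> {RV P >-> R}) (sigma : R) :
    Prop :=
  mutually_independent X /\
  forall i (A : set R), measurable A ->
    distribution P (X i) A = normal_prob 0 sigma A.

(* Main.v *)
From HB Require Import structures.
Require Import Defs.
From mathcomp Require Import all_boot all_order all_algebra.
From mathcomp Require Import all_classical all_reals all_analysis.
From mathcomp Require Import measurable_realfun ring lra.
Import Order.TTheory GRing.Theory Num.Theory.
Import numFieldNormedType.Exports.

Local Open Scope classical_set_scope.
Local Open Scope ring_scope.

Set Implicit Arguments.
Unset Strict Implicit.
Unset Printing Implicit Defensive.

(** The replica power is [(a . g)^2 + (b . g)^2], where [a] and [b] are the real and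
    imaginary parts of the Fourier vector.  For [0 < k < N/2] they are orthogonal and
    of equal squared length [1/(2N)]; for [k = N/2], [b = 0] and [|a|^2 = 1/N].
    The law of an i.i.d. centered normal family is invariant under Givens rotations:
    fixing the other coordinates reduces this to the plane, where a rotation
    is a product of three shears, which preserve Lebesgue measure by Tonelli and
    translation invariance.  Givens rotations bring [a] and [b] onto coordinate axes,
    which leaves the normal measure of an interval and that of a disc; the latter
    follows from the substitution [y = |x| t]. *)

(** * Affine changes of variable on the line *)

Section affine.
Context {R : realType}.
Local Notation mu := (@lebesgue_measure R).
Implicit Types (b c : R) (f : R -> \bar R).

Lemma measurable_affine b c : measurable_fun [set: R] (fun x => c * x + b).
Proof. by apply: measurable_funD => //; apply: measurable_funM. Qed.

(** By uniqueness of Lebesgue measure it suffices to compare both sides on half-open intervals,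
    whose preimages are intervals shorter by the factor [c]. *)
Lemma lebesgue_measure_affine b c (c0 : 0 < c) (A : set R) : measurable A ->
  mu A = (c%:E * mu ((fun x => (c * x + b)%R) @^-1` A))%E.
Proof.
move=> mA.
pose phi : R -> measurableTypeR R := fun x => c * x + b.
have mphi : measurable_fun setT phi := measurable_affine b c.
pose mphi_mixin := isMeasurableFun.Build _ _ _ _ _ mphi.
pose phi' : {mfun _ >-> _} := HB.pack phi mphi_mixin.
pose k : {nonneg R} := NngNum (ltW c0).
rewrite (@lebesgue_measure_unique _ (mscale k (pushforward mu phi')))//.
move=> _ [[x y] /= _ <-].
rewrite /mscale/= /pushforward /=.
rewrite [X in (_ * mu X)%E](_ : _ = `](x - b) / c, (y - b) / c]%classic); last first.
  apply/seteqP; split => z /=; rewrite !in_itv/= /phi ltr_pdivrMr// ler_pdivlMr//.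
    by rewrite ltrBlDr lerBrDr mulrC.
  by rewrite ltrBlDr lerBrDr mulrC.
rewrite !lebesgue_measure_itv/= !lte_fin ltr_pM2r ?invr_gt0// ltrD2r.
case: ifPn => _; last by rewrite mule0.
by rewrite -!EFinB -EFinM; congr EFin; field; rewrite gt_eqF.
Qed.

Lemma ge0_integral_affine b c f : 0 < c -> measurable_fun setT f ->
  (forall x, 0 <= f x)%E ->
  (\int[mu]_x (c%:E * f (c * x + b)%R) = \int[mu]_x f x)%E.
Proof.
move=> c0 mf f0.
pose phi : R -> measurableTypeR R := fun x => c * x + b.
have mphi : measurable_fun setT phi := measurable_affine b c.
pose mphi_mixin := isMeasurableFun.Build _ _ _ _ _ mphi.
pose phi' : {mfun _ >-> _} := HB.pack phi mphi_mixin.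
pose k : {nonneg R} := NngNum (ltW c0).
rewrite [RHS](@eq_measure_integral _ _ _ _ (mscale k (pushforward mu phi'))).
  rewrite ge0_integral_mscale//.
  rewrite ge0_integral_pushforward// preimage_setT ge0_integralZl//; last 2 first.
    exact: measurableT_comp.
    by rewrite lee_fin ltW.
by move=> A mA _; exact: lebesgue_measure_affine.
Qed.

Lemma ge0_integral_shift b f : measurable_fun setT f ->
  (forall x, 0 <= f x)%E ->
  (\int[mu]_x f (x + b)%R = \int[mu]_x f x)%E.
Proof.
move=> mf f0; rewrite -[RHS](@ge0_integral_affine b 1 f)//.
by apply: eq_integral => x _; rewrite mul1e mul1r.
Qed.

End affine.

(** * Shears and rotations of the plane *)

(* [lebesgue_measure] and [normal_prob] are measures on [measurableTypeR R], whose
   display is not that of [R]; typing the plane as [mR * mR] keeps unification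
   between the two from diverging. *)
Section rotation.
Context {R : realType}.
Local Notation mu := (@lebesgue_measure R).
Local Notation mR := (measurableTypeR R).
Implicit Types (t c s : R) (F : mR * mR -> \bar R).
Local Open Scope ereal_scope.

Let measurable_shear_snd t :
  measurable_fun [set: R * R] (fun z : R * R => (z.1, z.2 + t * z.1)%R).
Proof.
apply: measurable_fun_pair => //; apply: measurable_funD => //.
exact: measurable_funM.
Qed.

Let measurable_shear_fst t :
  measurable_fun [set: R * R] (fun z : R * R => (z.1 + t * z.2, z.2)%R).
Proof.
apply: measurable_fun_pair => //; apply: measurable_funD => //.
exact: measurable_funM.
Qed.

Lemma measurable_rotation c s : measurable_fun [set: R * R]
  (fun z : R * R => (c * z.1 + s * z.2, - s * z.1 + c * z.2)%R).
Proof.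
by apply: measurable_fun_pair; apply: measurable_funD => //; apply: measurable_funM.
Qed.

Lemma ge0_integral_shear_snd t F : measurable_fun setT F -> (forall z, 0 <= F z) ->
  \int[mu]_x \int[mu]_y F (x, (y + t * x)%R) = \int[mu]_x \int[mu]_y F (x, y).
Proof.
move=> mF F0; apply: eq_integral => x _.
apply: (@ge0_integral_shift _ _ (fun y => F (x, y))) => //.
exact: (@measurableT_comp _ _ _ mR (mR * mR)%type).
Qed.

(** Here the translated variable is the outer one, so Tonelli is applied before and after the
    translation. *)
Lemma ge0_integral_shear_fst t F : measurable_fun setT F -> (forall z, 0 <= F z) ->
  \int[mu]_x \int[mu]_y F ((x + t * y)%R, y) = \int[mu]_x \int[mu]_y F (x, y).
Proof.
move=> mF F0.
pose F' : mR * mR -> \bar R := fun z => F (z.1 + t * z.2, z.2)%R.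
have mF' : measurable_fun [set: mR * mR] F'.
  exact: (measurableT_comp mF (measurable_shear_fst t)).
transitivity (\int[mu]_y \int[mu]_x F' (x, y)).
  by apply: (@fubini_tonelli _ _ mR mR _ mu mu F' mF') => z; exact: F0.
transitivity (\int[mu]_y \int[mu]_x F (x, y)); last first.
  exact/esym/(@fubini_tonelli _ _ mR mR _ mu mu F mF F0).
apply: eq_integral => y _; rewrite /F'/=.
apply: (@ge0_integral_shift _ _ (fun x => F (x, y))) => //.
exact: (@measurableT_comp _ _ _ mR (mR * mR)%type).
Qed.

(* A rotation of angle [th <> pi] is a product of three shears, with parameters
   [tan (th / 2)], [- sin th] and [tan (th / 2)]. *)
Lemma ge0_integral_rotation c s F : (c ^+ 2 + s ^+ 2 = 1)%R -> (1 + c != 0)%R ->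
  measurable_fun setT F -> (forall z, 0 <= F z) ->
  \int[mu]_x \int[mu]_y F ((c * x + s * y)%R, (- s * x + c * y)%R) =
  \int[mu]_x \int[mu]_y F (x, y).
Proof.
move=> cs c1 mF F0; pose t := (s / (1 + c))%R.
have tc : (t * (1 + c) = s)%R by rewrite divfK.
have ts : (1 - s * t = c)%R.
  apply: (mulfI c1); rewrite mulrBr mulr1 mulrCA (mulrC (1 + c)%R t) tc.
  by move: cs; lra.
pose F1 : mR * mR -> \bar R := fun z => F (z.1 + t * z.2, z.2)%R.
pose F2 : mR * mR -> \bar R := fun z => F1 (z.1, z.2 + - s * z.1)%R.
have F10 z : 0 <= F1 z by exact: F0.
have F20 z : 0 <= F2 z by exact: F0.
have mF1 : measurable_fun setT F1.
  exact: (measurableT_comp mF (measurable_shear_fst t)).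
have mF2 : measurable_fun setT F2.
  exact: (measurableT_comp mF1 (measurable_shear_snd (- s))).
(* The right-hand side is sheared three times, into integrals of [F1], then [F2], then a third shear
   of [F2]. It remains to check that the composite shear is the rotation, which follows from
   [t * (1 + c) = s] and [1 - s * t = c]. *)
apply: etrans (ge0_integral_shear_fst t mF F0).
apply: etrans (ge0_integral_shear_snd (- s) mF1 F10).
apply: etrans (ge0_integral_shear_fst t mF2 F20).
apply: eq_integral => x _; apply: eq_integral => y _.
rewrite /F2 /F1 /=; congr (F (_, _)).
  by rewrite -[X in (_ + X * y)%R]tc -ts; ring.
by rewrite -[X in (_ + X * y)%R]ts; ring.
Qed.

End rotation.

(** * The centered normal law on the plane *)

Section normal_plane.
Context {R : realType} (sigma : R).
Local Notation mu := (@lebesgue_measure R).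
Local Notation mR := (measurableTypeR R).
Local Notation phi := (normal_pdf 0 sigma).
Local Notation gamma := (normal_prob 0 sigma).
Local Open Scope ereal_scope.

Let f (z : mR * mR) : \bar R := (phi z.1 * phi z.2)%:E.

Let f0 z : 0 <= f z.
Proof. by rewrite lee_fin mulr_ge0 ?normal_pdf_ge0. Qed.

Let mphi : measurable_fun [set: mR] phi := measurable_normal_pdf 0 sigma.

Let mf : measurable_fun setT f.
Proof.
apply/measurable_EFinP/measurable_funM.
  exact: (measurableT_comp mphi).
exact: (measurableT_comp mphi).
Qed.

(** The measure with density [f]. Once it is known to be a measure that factorizes on rectangles,
    uniqueness of the product measure identifies it with [gamma \x gamma], which therefore has this
    density. *)
Let nu (C : set (mR * mR)) : \bar R := \int[mu \x mu]_(z in C) f z.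

Let nu0 : nu set0 = 0. Proof. exact: integral_set0. Qed.

Let nu_ge0 C : 0 <= nu C. Proof. exact: integral_ge0. Qed.

Let nu_sigma_additive : semi_sigma_additive nu.
Proof.
move=> A mA tA mUA; rewrite /nu ge0_integral_bigcup//; last exact: measurable_funTS.
by apply: is_cvg_ereal_nneg_natsum_cond => n _ _; exact: integral_ge0.
Qed.

HB.instance Definition _ := isMeasure.Build _ _ _ nu nu0 nu_ge0 nu_sigma_additive.

Let nuE (C : set (mR * mR)) : measurable C ->
  nu C = \int[mu]_x \int[mu]_y (\1_C (x, y) * (phi x * phi y))%:E.
Proof.
move=> mC; pose g z := (\1_C z * (phi z.1 * phi z.2))%:E.
rewrite /nu integral_mkcond.
transitivity (\int[mu \x mu]_z g z).
  apply: eq_integral => z _; rewrite patchE /g indicE.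
  by case: ifPn => zC; rewrite ?mul1r ?mul0r.
have mg : measurable_fun setT g.
  apply/measurable_EFinP/measurable_funM; first exact: measurable_indic.
  exact/measurable_EFinP.
apply: (@fubini_tonelli1 _ _ mR mR _ mu mu g mg) => z.
by rewrite lee_fin mulr_ge0// mulr_ge0 ?normal_pdf_ge0.
Qed.

Let nuX (A B : set mR) : measurable A -> measurable B ->
  nu (A `*` B) = gamma A * gamma B.
Proof.
move=> mA mB; rewrite nuE; last exact: measurableX.
transitivity (\int[mu]_x ((\1_A x * phi x)%:E * gamma B)).
  apply: eq_integral => x _; rewrite /normal_prob [X in _ * X]integral_mkcond.
  rewrite -ge0_integralZl//=.
  - apply: eq_integral => y _; rewrite patchE !indicE in_setX/=.
    by case: (y \in B); case: (x \in A);
      rewrite ?mule0 ?mul0r ?mul1r ?mul0e ?EFinM ?mul0e.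
  - apply/(measurable_restrictT _ _).1 => //.
    by apply/measurable_EFinP; exact: measurable_funTS.
  - by move=> y _; apply: erestrict_ge0 => // y' _; rewrite lee_fin normal_pdf_ge0.
  - by rewrite lee_fin mulr_ge0// normal_pdf_ge0.
rewrite ge0_integralZr//=.
- congr (_ * _); rewrite [RHS]integral_mkcond; apply: eq_integral => x _.
  by rewrite patchE indicE; case: ifPn => _; rewrite ?mul1r ?mul0r.
- by apply/measurable_EFinP/measurable_funM => //; exact: measurable_indic.
- by move=> x _; rewrite lee_fin mulr_ge0// normal_pdf_ge0.
Qed.

Lemma normal_probXE (C : set (mR * mR)) : measurable C ->
  (gamma \x gamma) C =
  \int[mu]_x \int[mu]_y (\1_C (x, y) * (phi x * phi y))%:E.
Proof.
move=> mC; rewrite -nuE//.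
exact: (@product_measure_unique _ _ mR mR _ gamma gamma nu nuX C mC).
Qed.

(** The density depends only on [x ^+ 2 + y ^+ 2], which a rotation preserves, and so does the
    rotated integral. *)
Lemma normal_probX_rotation c s (C : set (mR * mR)) : sigma != 0%R ->
  measurable C -> (c ^+ 2 + s ^+ 2 = 1)%R -> (1 + c != 0)%R ->
  (gamma \x gamma)
    ((fun z => ((c * z.1 + s * z.2)%R, (- s * z.1 + c * z.2)%R)) @^-1` C) =
  (gamma \x gamma) C.
Proof.
move=> s0 mC cs c1.
pose F (z : mR * mR) := (\1_C z * (phi z.1 * phi z.2))%:E.
have mF : measurable_fun setT F.
  apply/measurable_EFinP/measurable_funM; first exact: measurable_indic.
  exact/measurable_EFinP.
have F0 z : 0 <= F z by rewrite lee_fin mulr_ge0// mulr_ge0 ?normal_pdf_ge0.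
rewrite (normal_probXE mC) normal_probXE; last first.
  by rewrite -[X in measurable X]setTI; exact: measurable_rotation.
apply: etrans (ge0_integral_rotation cs c1 mF F0).
apply: eq_integral => x _; apply: eq_integral => y _; congr (_ * _)%:E.
rewrite /= normal_pdfE// /normal_fun mulrACA [RHS]mulrACA -!expRD; congr (_ * expR _)%R.
rewrite !subr0 -!mulrDl -!opprD; congr (- _ / _)%R.
by rewrite -[LHS]mul1r -cs; ring.
Qed.

End normal_plane.

(** * From rectangles to planar sets *)

Section normal_pair.
Context d (T : measurableType d) {R : realType} (P : probability T R) (sigma : R).
Local Notation mR := (measurableTypeR R).
Local Notation gamma := (normal_prob 0 sigma).
Local Open Scope ereal_scope.

(** The law of the pair restricted to [E] and divided by [P E] agrees with [gamma \x gamma] on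
    rectangles, hence everywhere. The event [E] will carry the constraints on the other
    coordinates. *)
Lemma pair_law_normal_probX (X Y : T -> R) (E : set T) :
  measurable_fun setT X -> measurable_fun setT Y -> measurable E ->
  (forall A B : set R, measurable A -> measurable B ->
    P ((X @^-1` A `&` Y @^-1` B) `&` E) = gamma A * gamma B * P E) ->
  forall C : set (mR * mR), measurable C ->
    P ((fun w => (X w, Y w)) @^-1` C `&` E) = (gamma \x gamma) C * P E.
Proof.
move=> mX mY mE XYE C mC.
pose phi : T -> mR * mR := fun w => (X w, Y w).
have mphi : measurable_fun setT phi by exact: measurable_fun_pair.
(* A null [E] makes both sides vanish; otherwise one may normalize by [P E]. *)
have [PE0|PE0] := eqVneq (P E) 0.
  rewrite PE0 mule0; apply/eqP; rewrite eq_le measure_ge0 andbT -PE0.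
  apply: le_measure; rewrite ?inE//; apply: measurableI => //.
  by rewrite -[X in measurable X]setTI; exact: mphi.
pose mphi_mixin := isMeasurableFun.Build _ _ _ _ _ mphi.
pose phi' : {mfun _ >-> _} := HB.pack phi mphi_mixin.
have PEr : P E = (fine (P E))%:E by rewrite fineK// fin_num_measure.
have PE_gt0 : (0 < fine (P E))%R.
  by rewrite -lte_fin -PEr lt0e PE0 measure_ge0.
have k0 : (0 <= (fine (P E))^-1)%R by rewrite invr_ge0 ltW.
pose k : {nonneg R} := NngNum k0.
rewrite (@product_measure_unique _ _ mR mR _ gamma gamma
  (mscale k (pushforward (mrestr P mE) phi')))//.
  rewrite /mscale/= /pushforward/= /mrestr muleAC PEr.
  rewrite -EFinM mulVf ?gt_eqF// mul1e//.
move=> A B mA mB; rewrite /mscale/= /pushforward/= /mrestr.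
transitivity (k%:num%:E * (gamma A * gamma B * P E)).
  by congr (_ * _); exact: XYE.
by rewrite muleCA PEr -EFinM mulVf ?gt_eqF// mule1.
Qed.

End normal_pair.

(** * Radial integrals *)

Section radial.
Context {R : realType}.
Local Notation mu := (@lebesgue_measure R).
Local Notation mR := (measurableTypeR R).
Local Open Scope ereal_scope.

(* Substitute [y = |x| t] in the inner integral, exchange, then rescale [x] by
   [sqrt (1 + t ^ 2)]. *)
Lemma ge0_integral_radial (h : R -> \bar R) :
  measurable_fun setT h -> (forall u, 0 <= h u) ->
  \int[mu]_x \int[mu]_y h (x ^+ 2 + y ^+ 2)%R =
  \int[mu]_t ((1 + t ^+ 2)^-1)%:E * \int[mu]_z (`|z|%:E * h (z ^+ 2)%R).
Proof.
move=> mh h0.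
pose B := \int[mu]_z (`|z|%:E * h (z ^+ 2)%R).
have sqrD_neq0 (t : R) : (1 + t ^+ 2 != 0)%R.
  by rewrite gt_eqF// ltr_wpDr ?sqr_ge0.
pose F : mR * mR -> \bar R := fun z => `|z.1|%:E * h (z.1 ^+ 2 * (1 + z.2 ^+ 2))%R.
have F0 z : 0 <= F z by rewrite mule_ge0.
have mF : measurable_fun [set: mR * mR] F.
  have mF' : measurable_fun [set: R * R]
      (fun z : R * R => `|z.1|%:E * h (z.1 ^+ 2 * (1 + z.2 ^+ 2))%R).
    apply: emeasurable_funM.
      by apply/measurable_EFinP; exact: measurableT_comp.
    apply: (measurableT_comp mh); apply: measurable_funM.
      exact: measurable_funX.
    by apply: measurable_funD => //; exact: measurable_funX.
  exact: mF'.
have BE t : \int[mu]_x F (x, t) = (1 + t ^+ 2)^-1%:E * B.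
  pose c : R := Num.sqrt (1 + t ^+ 2).
  have c0 : (0 < c)%R by rewrite sqrtr_gt0 ltr_wpDr ?sqr_ge0.
  have c2 : (c ^+ 2 = 1 + t ^+ 2)%R by rewrite sqr_sqrtr// addr_ge0 ?sqr_ge0.
  pose k (z : R) := `|z|%:E * h (z ^+ 2)%R.
  have mk : measurable_fun setT k.
    apply: emeasurable_funM; first exact/measurable_EFinP.
    by apply: (measurableT_comp mh); exact: measurable_funX.
  have k0 z : 0 <= k z by rewrite mule_ge0.
  rewrite /B -(@ge0_integral_affine _ 0%R c k c0 mk k0) -ge0_integralZl//=.
  - apply: eq_integral => x _; rewrite /k /F/= addr0 exprMn normrM gtr0_norm//.
    rewrite !muleA -!EFinM -c2; congr (_%:E * h _); last by rewrite mulrC.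
    by field; rewrite gt_eqF.
  - apply: emeasurable_funM => //; apply: (measurableT_comp mk).
    exact: (measurable_affine 0 c).
  - by move=> x _; rewrite mule_ge0// lee_fin ltW.
  - by rewrite lee_fin invr_ge0 addr_ge0 ?sqr_ge0.
pose F1 : mR * mR -> \bar R := fun z => h (z.1 ^+ 2 + z.2 ^+ 2)%R.
have mF1 : measurable_fun [set: mR * mR] F1.
  have mF1' : measurable_fun [set: R * R] (fun z : R * R => h (z.1 ^+ 2 + z.2 ^+ 2)%R).
    by apply: (measurableT_comp mh); apply: measurable_funD; exact: measurable_funX.
  exact: mF1'.
have F10 z : 0 <= F1 z by exact: h0.
transitivity (\int[mu]_x \int[mu]_t F (x, t)).
  (* The substitution [y = |x| t] is invertible only for [x != 0], so the inner integrals are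
     compared off the null set [[set 0]]. *)
  apply: ae_eq_integral => //.
  - exact: (@measurable_fun_fubini_tonelli_F _ _ mR mR _ mu _ mF1 F10).
  - exact: (@measurable_fun_fubini_tonelli_F _ _ mR mR _ mu _ mF F0).
  - exists [set 0%R]; split => //; first exact: lebesgue_measure_set1.
    move=> x /= /not_implyP[_ xE]; apply: contrapT => /eqP x0; apply: xE.
    have x0' : (0 < `|x|)%R by rewrite normr_gt0.
    rewrite -(@ge0_integral_affine _ 0%R `|x| (fun y => h (x ^+ 2 + y ^+ 2)%R))//.
      apply: eq_integral => y _; rewrite /F/= addr0 exprMn real_normK ?num_real//.
      by rewrite mulrDr mulr1.
    apply: (measurableT_comp mh); apply: measurable_funD => //.
rewrite (@fubini_tonelli _ _ mR mR _ mu mu F mF F0).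
under eq_integral do rewrite BE.
rewrite ge0_integralZr//.
- apply/measurable_EFinP; have := @continuous_oneDsqrV R.
  exact: continuous_measurable_fun.
- by move=> t _; rewrite lee_fin invr_ge0 addr_ge0 ?sqr_ge0.
- by apply: integral_ge0 => z _; rewrite mule_ge0.
Qed.

Lemma ge0_integral_even (f : R -> \bar R) :
  measurable_fun setT f -> (forall x, 0 <= f x) -> (forall x, f (- x)%R = f x) ->
  \int[mu]_x f x = 2%:E * \int[mu]_(x in `[0%R, +oo[) f x.
Proof.
move=> mf f0 fN.
rewrite -(@setUv _ `[0%R, +oo[%classic) ge0_integral_setU//=; last 3 first.
- by apply: measurableC.
- by rewrite setUv.
- by apply/disj_setPCl.
rewrite setCitvr integral_itv_bndo_bndc; last exact: measurable_funTS.
under [X in _ + X]eq_integral do rewrite -fN.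
rewrite -ge0_integration_by_substitution0// -[X in X + _]mul1e -[X in _ + X]mul1e.
by rewrite -ge0_muleDl.
Qed.

Lemma integral_oneDsqrV : \int[mu]_t ((1 + t ^+ 2)^-1)%:E = pi%:E.
Proof.
rewrite ge0_integral_even//.
- rewrite [X in _ * X](_ : _ = \int[mu]_(x in `[0%R, +oo[) (oneDsqr x)^-1%:E)//.
  by rewrite integral0y_oneDsqr -EFinM mulrCA divff ?mulr1.
- apply/measurable_EFinP; have := @continuous_oneDsqrV R.
  exact: continuous_measurable_fun.
- by move=> t; rewrite lee_fin invr_ge0 addr_ge0 ?sqr_ge0.
- by move=> t; rewrite sqrrN.
Qed.

End radial.

(** * Normal measure of discs and of symmetric intervals *)

Section disc.
Context {R : realType} (sigma : R) (sigma_gt0 : 0 < sigma).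
Local Notation mu := (@lebesgue_measure R).
Local Notation mR := (measurableTypeR R).
Local Notation phi := (normal_pdf 0 sigma).
Local Notation gamma := (normal_prob 0 sigma).
Local Open Scope ereal_scope.

Lemma integral_itv_id_expR (a r : R) : (0 < a)%R -> (0 <= r)%R ->
  \int[mu]_(z in `[0%R, r]) (z * expR (- (a * z ^+ 2)))%:E =
  ((1 - expR (- (a * r ^+ 2))) / (2 * a))%:E.
Proof.
(* The interval reduced to a point is treated apart; the fundamental theorem of calculus is applied
   with [0 < r]. *)
move=> a0; rewrite le_eqVlt => /predU1P[<-|r0].
  by rewrite set_itv1 integral_set1 expr0n/= mulr0 oppr0 expR0 subrr mul0r.
pose F (z : R) : R := (- (2 * a)^-1 * expR (- (a * z ^+ 2)))%R.
have dF (z : R) : is_derive z 1%R F (z * expR (- (a * z ^+ 2)))%R.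
  by apply: is_derive_eq; rewrite /GRing.scale/=; field; rewrite gt_eqF.
have cF : continuous F.
  by move=> z; apply/differentiable_continuous/derivable1_diffP; have [] := dF z.
have cf : continuous (fun z : R => z * expR (- (a * z ^+ 2)) : R)%R.
  move=> z; apply/differentiable_continuous/derivable1_diffP.
  by apply: ex_derive.
rewrite (@continuous_FTC2 _ _ F)//.
- rewrite -EFinB /F expr0n/= mulr0 oppr0 expR0; congr EFin; field.
  by rewrite gt_eqF.
- exact: continuous_subspaceT.
- split; first by move=> z _; have [] := dF z.
    by apply: cvg_at_right_filter; exact: cF.
  by apply: cvg_at_left_filter; exact: cF.
- by move=> z _; rewrite derive1E; have [] := dF z.
Qed.

Lemma measurable_disc (q : R) :
  measurable [set z : R * R | (z.1 ^+ 2 + z.2 ^+ 2 <= q)%R].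
Proof.
pose f (z : R * R) := (z.1 ^+ 2 + z.2 ^+ 2)%R.
rewrite -[X in measurable X]setTI.
apply: (@measurable_fun_le _ _ _ _ f (cst q)) => //.
by apply: measurable_funD; exact: measurable_funX.
Qed.

(** With [a = 1 / (2 sigma^2)] the density is [(a / pi) e^(-a u)] at [u = x^2 + y^2]. The radial
    formula contributes a factor [pi], which cancels the one in the density, and a factor [|z|],
    which makes the remaining integral elementary. *)
Lemma normal_probX_disc (q : R) : (0 <= q)%R ->
  (gamma \x gamma) [set z : mR * mR | (z.1 ^+ 2 + z.2 ^+ 2 <= q)%R] =
  (1 - expR (- (q / (sigma ^+ 2 *+ 2))))%:E.
Proof.
move=> q0.
have s2_gt0 : (0 < sigma ^+ 2 *+ 2)%R by rewrite pmulrn_lgt0// exprn_gt0.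
have s0 : sigma != 0%R by rewrite gt_eqF.
pose a : R := (sigma ^+ 2 *+ 2)^-1%R.
have a0 : (0 < a)%R by rewrite invr_gt0.
pose p2 := (normal_peak sigma ^+ 2)%R.
have p2_ge0 : (0 <= p2)%R by rewrite sqr_ge0.
have p2E : (p2 = a / pi)%R.
  rewrite /p2 /normal_peak exprVn -mulrnAl sqr_sqrtr ?invfM//.
  by rewrite mulr_ge0 ?pi_ge0// ltW.
pose e (u : R) : R := (p2 * expR (- (a * u)))%R.
have e0 u : (0 <= e u)%R by rewrite mulr_ge0 ?expR_ge0.
have me : measurable_fun setT e.
  apply: measurable_funM => //; apply: measurableT_comp => //.
  by apply: measurableT_comp => //; apply: measurable_funM.
pose h (u : R) := (\1_`]-oo, q] u * e u)%:E.
have h0 u : 0 <= h u by rewrite lee_fin mulr_ge0.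
have mh : measurable_fun [set: R] h.
  by apply/measurable_EFinP/measurable_funM => //; exact: measurable_indic.
pose k (z : R) := `|z|%:E * h (z ^+ 2)%R.
have mk : measurable_fun setT k.
  apply: emeasurable_funM; first exact/measurable_EFinP.
  by apply: (measurableT_comp mh); exact: measurable_funX.
have mD := measurable_disc q.
rewrite normal_probXE//.
transitivity (\int[mu]_x \int[mu]_y h (x ^+ 2 + y ^+ 2)%R).
  apply: eq_integral => x _; apply: eq_integral => y _; congr (_%:E).
  rewrite /h /e /p2 !indicE; congr (_ * _)%R.
  rewrite !normal_pdfE// /normal_fun mulrACA -expr2 -expRD; congr (_ * expR _)%R.
  by rewrite !subr0 /a; field; rewrite gt_eqF.
rewrite ge0_integral_radial// integral_oneDsqrV ge0_integral_even//; last 2 first.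
- by move=> z; rewrite mule_ge0.
- by move=> z; rewrite normrN sqrrN.
(* For [z >= 0] the indicator of [z ^+ 2 <= q] hidden in [h] cuts the half-line at [Num.sqrt q]. *)
rewrite [X in _ * (_ * X)](_ : _ =
    \int[mu]_(z in `[0%R, Num.sqrt q]) (p2%:E * (z * expR (- (a * z ^+ 2)))%:E)).
  rewrite ge0_integralZl//=.
  - rewrite integral_itv_id_expR ?sqrtr_ge0// sqr_sqrtr// -!EFinM p2E.
    rewrite (mulrC a q); congr EFin.
    by move: (pi : R) (pi_gt0 R) => p p_gt0; field; rewrite !gt_eqF.
  - apply/measurable_EFinP/measurable_funTS; apply: measurable_funM => //.
    apply: measurableT_comp => //; apply: measurableT_comp => //.
    exact: measurable_funM.
  - by move=> z; rewrite in_itv/= => /andP[z0 _]; rewrite lee_fin mulr_ge0 ?expR_ge0.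
rewrite integral_mkcond [RHS]integral_mkcond; apply: eq_integral => z _.
rewrite !patchE !mem_setE !in_itv/= andbT.
have [z0|z0]//= := leP 0%R z.
rewrite -(@ler_pXn2r _ 2)// ?nnegrE ?sqrtr_ge0// sqr_sqrtr//.
rewrite /h /e indicE mem_setE in_itv/= ger0_norm// -EFinM.
by case: (_ <= q)%R; rewrite ?mul1r ?mul0r ?mulr0 -?EFinM// mulrCA.
Qed.

(** The substitution [x = c u] with [c^2 = 2 sigma^2] turns the density into [e^(-u^2) / sqrt pi];
    evenness supplies the factor 2 of [erf]. *)
Lemma normal_prob_itv_erf (r : R) : (0 <= r)%R ->
  gamma `[(- r)%R, r] = (erf (r / Num.sqrt (sigma ^+ 2 *+ 2)))%:E.
Proof.
move=> r0; pose c := Num.sqrt (sigma ^+ 2 *+ 2).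
have s2_gt0 : (0 < sigma ^+ 2 *+ 2)%R by rewrite pmulrn_lgt0// exprn_gt0.
have s0 : sigma != 0%R by rewrite gt_eqF.
have c0 : (0 < c)%R by rewrite sqrtr_gt0.
have c2 : (c ^+ 2 = sigma ^+ 2 *+ 2)%R by rewrite sqr_sqrtr// ltW.
have mphi : measurable_fun [set: R] phi := measurable_normal_pdf 0 sigma.
rewrite /normal_prob integral_mkcond ge0_integral_even//=; last 3 first.
- apply/(measurable_restrictT _ _).1 => //.
  by apply/measurable_EFinP; exact: measurable_funTS.
- by move=> x; apply: erestrict_ge0 => // y _; rewrite lee_fin normal_pdf_ge0.
- move=> x; rewrite !patchE !mem_setE !in_itv/= lerN2 lerNl andbC.
  by case: ifP => // _; rewrite !normal_pdfE// /normal_fun !subr0 sqrrN.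
rewrite integral_mkcond.
rewrite -(@ge0_integral_affine _ 0%R c)//; last 2 first.
- apply/(measurable_restrictT _ _).1 => //.
  apply: measurable_funTS; apply/(measurable_restrictT _ _).1 => //.
  by apply/measurable_EFinP; exact: measurable_funTS.
- move=> x; apply: erestrict_ge0 => // y _.
  by apply: erestrict_ge0 => // z _; rewrite lee_fin normal_pdf_ge0.
rewrite (_ : \int[mu]_x _ = (Num.sqrt pi)^-1%:E *
    \int[mu]_(u in `[0%R, (r / c)%R]) (gauss_fun u)%:E); last first.
  rewrite -ge0_integralZl//=; last 2 first.
  - by apply/measurable_EFinP; apply: measurable_funTS; exact: measurable_gauss_fun.
  - by move=> u _; rewrite lee_fin gauss_fun_ge0.
  rewrite [RHS]integral_mkcond; apply: eq_integral => u _.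
  rewrite !patchE !mem_setE !in_itv/= andbT addr0 pmulr_rge0//.
  case: (leP 0%R u) => u0 /=; last by rewrite mule0.
  rewrite ler_pdivlMr// mulrC.
  rewrite (le_trans _ (mulr_ge0 u0 (ltW c0))) ?oppr_le0//=.
  case: ifPn => _; last by rewrite mule0.
  rewrite -!EFinM normal_pdfE// /normal_peak -mulrnAl sqrtrM ?ltW// -/c.
  rewrite /normal_fun subr0 exprMn -c2 /gauss_fun mulNr mulfK ?expf_neq0 ?gt_eqF//.
  by rewrite invfM !mulrA divff ?gt_eqF// mul1r.
rewrite /erf ifT; last by rewrite divr_ge0// ltW.
rewrite /Rintegral EFinM fineK; last first.
  apply: integrable_fin_num => //.
  exact: integrableS (subsetT _) (@integrableT_gauss R).
by rewrite muleA -EFinM.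
Qed.

End disc.

(** * Givens rotations of finite families *)

Section givens.
Context {R : realType} {I : finType}.
Implicit Types (a b u v : I -> R) (c s : R) (i j : I).

Definition dot u v : R := \sum_i u i * v i.

Definition givens c s i j u : I -> R := fun k =>
  if k == i then c * u i + s * u j
  else if k == j then - s * u i + c * u j else u k.

Lemma dot_givens c s i j u v : c ^+ 2 + s ^+ 2 = 1 -> i != j ->
  dot (givens c s i j u) (givens c s i j v) = dot u v.
Proof.
move=> cs ij; have ji : j != i by rewrite eq_sym.
have dotE u' v' : dot u' v' = u' i * v' i + u' j * v' j +
    \sum_(k | (k != i) && (k != j)) u' k * v' k.
  by rewrite /dot (bigD1 i)//= (bigD1 j)//= addrA.
rewrite !dotE /givens !eqxx (negPf ji); congr (_ + _).
  transitivity ((c ^+ 2 + s ^+ 2) * (u i * v i + u j * v j)); first by ring.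
  by rewrite cs mul1r.
by apply: eq_bigr => k /andP[/negPf-> /negPf->].
Qed.

(** The rotation has cosine and sine [u i / r] and [u j / r], where [r] is the length of
    [(u i, u j)]. A half-turn would force [u j = 0], and in that case the identity is chosen
    instead; so [1 + c] never vanishes, as the decomposition into shears requires. *)
Lemma givens_zero u i j : exists c s,
  [/\ c ^+ 2 + s ^+ 2 = 1, 1 + c != 0 & - s * u i + c * u j = 0].
Proof.
have [uj0|uj0] := eqVneq (u j) 0.
  exists 1, 0; rewrite uj0 oppr0 mul0r mulr0 addr0 expr0n expr1n addr0.
  by split => //; lra.
pose r := Num.sqrt (u i ^+ 2 + u j ^+ 2).
have r2 : r ^+ 2 = u i ^+ 2 + u j ^+ 2 by rewrite sqr_sqrtr// addr_ge0 ?sqr_ge0.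
have r0 : r != 0.
  by rewrite -sqrf_eq0 r2 paddr_eq0 ?sqr_ge0// !sqrf_eq0 negb_and uj0 orbT.
exists (u i / r), (u j / r); split; last by field.
- by rewrite !exprMn -mulrDl -r2 -exprMn divff// expr1n.
- apply/eqP => c1; have uir : u i = - r.
    move/eqP: c1; rewrite addrC addr_eq0 => /eqP c1.
    by rewrite -(divfK r0 (u i)) c1 mulN1r.
  move: r2; rewrite uir sqrrN => /eqP.
  by rewrite -subr_eq0 opprD addrA subrr sub0r oppr_eq0 sqrf_eq0 (negPf uj0).
Qed.

Lemma dot_supp1 i u v : (forall k, k != i -> u k = 0) -> dot u v = u i * v i.
Proof.
move=> u0; rewrite /dot (bigD1 i)//= big1 ?addr0// => k ki.
by rewrite u0// mul0r.
Qed.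

Lemma dot_gt0_exists u : 0 < dot u u -> exists i, u i != 0.
Proof.
move=> uu_gt0; apply: contrapT => /forallNP u0; move: uu_gt0.
rewrite /dot big1 ?ltxx// => i _.
by have /negP/negPn/eqP-> := u0 i; rewrite mul0r.
Qed.

End givens.

(** * Independent normal families and their linear forms *)

Section normal_family.
Context d (T : measurableType d) {R : realType} (P : probability T R)
  (sigma : R) (sigma_gt0 : 0 < sigma) {I : finType}.
Local Notation gamma := (normal_prob 0 sigma).
Local Notation mR := (measurableTypeR R).
Implicit Types (X : I -> T -> R) (a b u v : I -> R).

(** One product formula over all of [I] encodes both independence and the marginals, since some of
    the [A i] may be the whole line. Taking [X] as a family of plain functions lets it be applied
    directly to rotated families. *)
Definition normal_family X :=
  (forall i, measurable_fun setT (X i)) /\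
  forall A : I -> set R, (forall i, measurable (A i)) ->
    P [set w | forall i, A i (X i w)] = (\prod_i gamma (A i))%E.

Lemma iid_normal_family (g : I -> {RV P >-> R}) :
  iid_centered_normal g sigma -> normal_family g.
Proof.
move=> [indep law]; split => [i|A mA]; first exact: measurable_funPT.
have := indep [set: I]%SET A mA.
rewrite (_ : \bigcap_(i in _) _ = [set w | forall i, A i (g i w)]); last first.
  by apply/seteqP; split => w /= h i; [apply: h => /=; rewrite inE|move=> _; exact: h].
move=> ->; rewrite big_mkcond/=; apply: eq_bigr => i _.
by rewrite inE; exact: law.
Qed.

Lemma normal_family_prob X : normal_family X ->
  forall C : set R, forall i, measurable C ->
  P (X i @^-1` C) = gamma C.
Proof.
move=> [mX lawX] C i mC.
pose B k : set R := if k == i then C else setT.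
have mB k : measurable (B k) by rewrite /B; case: ifP.
rewrite (_ : _ @^-1` _ = [set w | forall k, B k (X k w)]).
  rewrite lawX// (bigD1 i)//= big1 ?mule1 ?/B ?eqxx// => k /negPf ki.
  by rewrite /B ki; exact: probability_setT.
apply/seteqP; split => w /=; last by move=> /(_ i); rewrite /B eqxx.
by move=> Xw k; rewrite /B; case: eqP => // ->.
Qed.

Local Open Scope ereal_scope.

(** A rotation does not send rectangles to rectangles, so two coordinates must be allowed an
    arbitrary measurable planar set while the others stay in a box. *)
Lemma normal_family_pair X i j (A : I -> set R) (C : set (mR * mR)) :
  normal_family X -> i != j -> (forall k, measurable (A k)) -> measurable C ->
  P ((fun w => (X i w, X j w)) @^-1` C `&`
     [set w | forall k, k != i -> k != j -> A k (X k w)]) =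
  (gamma \x gamma) C * \prod_(k | (k != i) && (k != j)) gamma (A k).
Proof.
move=> [mX lawX] ij mA mC; have ji : j != i by rewrite eq_sym.
pose E := [set w | forall k, k != i -> k != j -> A k (X k w)].
pose q := \prod_(k | (k != i) && (k != j)) gamma (A k).
have rect (B1 B2 : set R) : measurable B1 -> measurable B2 ->
    P ((X i @^-1` B1 `&` X j @^-1` B2) `&` E) = gamma B1 * gamma B2 * q.
  move=> mB1 mB2.
  pose A' k := if k == i then B1 else if k == j then B2 else A k.
  have mA' k : measurable (A' k) by rewrite /A'; do 2 case: ifP => // _.
  transitivity (P [set w | forall k, A' k (X k w)]).
    congr (P _); apply/seteqP; split => w /=.
      move=> [[Xi Xj] Ew] k; rewrite /A'.
      by case: eqVneq => [->//|ki]; case: eqVneq => [->//|kj]; exact: Ew.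
    move=> A'X; split; first split.
    - by have := A'X i; rewrite /A' eqxx.
    - by have := A'X j; rewrite /A' eqxx (negPf ji).
    - by move=> k /negPf ki /negPf kj; have := A'X k; rewrite /A' ki kj.
  rewrite lawX// (bigD1 i)//= (bigD1 j)//= {1 2}/A' !eqxx (negPf ji) muleA.
  by congr (_ * _); apply: eq_bigr => k /andP[/negPf ki /negPf kj]; rewrite /A' ki kj.
have mE : measurable E.
  rewrite (_ : E = \bigcap_(k in [set k | (k != i) && (k != j)]) X k @^-1` A k).
    apply: fin_bigcap_measurable => [|k _]; first exact: finite_finset.
    by rewrite -[X in measurable X]setTI; exact: mX.
  apply/seteqP; split => w /=; first by move=> Ew k /andP[]; exact: Ew.
  by move=> Ew k ki kj; apply: Ew; rewrite /= ki.
have PE : P E = q.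
  have := rect setT setT measurableT measurableT.
  rewrite !preimage_setT !setTI => ->.
  by rewrite [gamma setT](@probability_setT _ mR _ gamma) !mul1e.
rewrite -/E -/q -PE; apply: pair_law_normal_probX => // B1 B2 mB1 mB2.
by rewrite rect// PE.
Qed.

(** The rotated family lies in a box exactly when [(X i, X j)] lies in the inverse rotation of a
    rectangle and the other coordinates in their sides of the box. Rotation invariance of
    [gamma \x gamma] gives back the rectangle. *)
Lemma normal_family_givens X i j c s :
  normal_family X -> i != j -> (c ^+ 2 + s ^+ 2 = 1)%R -> (1 + c != 0)%R ->
  normal_family (fun k w => givens c s i j (X ^~ w) k).
Proof.
move=> nX ij cs c1; have [mX lawX] := nX; have ji : j != i by rewrite eq_sym.
split=> [k|A mA].
  rewrite /givens; case: (k == i); last (case: (k == j) => //).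
    by apply: measurable_funD; apply: measurable_funM.
  by apply: measurable_funD; apply: measurable_funM.
pose C : set (mR * mR) :=
  (fun z => ((c * z.1 + s * z.2)%R, (- s * z.1 + c * z.2)%R)) @^-1` (A i `*` A j).
have mAA : measurable (A i `*` A j : set (mR * mR)).
  exact: (@measurableX _ _ mR mR _ _ (mA i) (mA j)).
have mC : measurable C by rewrite -[X in measurable X]setTI; exact: measurable_rotation.
transitivity (P ((fun w => (X i w, X j w)) @^-1` C `&`
     [set w | forall k, k != i -> k != j -> A k (X k w)])).
  congr (P _); apply/seteqP; split => w /=.
    move=> AX; split.
      by split => /=; [have := AX i|have := AX j]; rewrite /givens eqxx ?(negPf ji).
    by move=> k /negPf ki /negPf kj; have := AX k; rewrite /givens ki kj.
  move=> [[/= Ai Aj] Ak] k; rewrite /givens.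
  case: eqVneq => [->//|ki]; case: eqVneq => [->//|kj]; exact: Ak.
rewrite normal_family_pair// normal_probX_rotation ?(gt_eqF sigma_gt0)//.
rewrite (@product_measure1E _ _ mR mR _ gamma gamma _ _ (mA i) (mA j)).
by rewrite [RHS](bigD1 i)//= [X in _ = _ * X](bigD1 j)//= muleA.
Qed.

Local Close Scope ereal_scope.

(* Composing Givens rotations in the planes [(i, j)], [j] in [l], one moves all
   the mass of [a] on [l] into the coordinate [i]. *)
Lemma normal_family_reduction i (l : seq I) a : i \notin l ->
  exists rho : (I -> R) -> I -> R,
  [/\ forall u v, dot (rho u) (rho v) = dot u v,
      forall X, normal_family X -> normal_family (fun k w => rho (X ^~ w) k),
      forall j, j \in l -> rho a j = 0 &
      forall u, (forall k, k \in i :: l -> u k = 0) -> rho u = u].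
Proof.
elim: l => [_|j l IH]; first by exists id.
rewrite inE negb_or => /andP[ij il].
have [rho [rho_dot rhoX rho0 rho_id]] := IH il.
have [c [s [cs c1 cj]]] := givens_zero (rho a) i j.
exists (fun u => givens c s i j (rho u)); split.
- by move=> u v; rewrite dot_givens.
- by move=> X nX; exact: (normal_family_givens (rhoX _ nX)).
- move=> k; rewrite inE /givens; have [->|kj]/= := eqVneq k j.
    by rewrite eq_sym (negPf ij).
  by move=> kl; case: eqVneq => [ki|_]; [rewrite -ki kl in il|exact: rho0].
- move=> u u0; rewrite rho_id; last first.
    by move=> k; rewrite inE => /orP[/eqP->|kl]; rewrite u0// !inE ?eqxx ?kl ?orbT.
  have ui : u i = 0 by rewrite u0// inE eqxx.
  have uj : u j = 0 by rewrite u0// !inE eqxx orbT.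
  apply/funext => k; rewrite /givens ui uj !mulr0 addr0.
  by case: eqVneq => [->//|_]; case: eqVneq => [->|].
Qed.

(* Two orthogonal vectors of equal length become multiples of two basis vectors. *)
Lemma normal_family_dot2_disc X a b (v p : R) : normal_family X ->
  0 < v -> dot a a = v -> dot b b = v -> dot a b = 0 -> 0 <= p ->
  P [set w | dot a (X ^~ w) ^+ 2 + dot b (X ^~ w) ^+ 2 <= p] =
  (1 - expR (- (p / v / (sigma ^+ 2 *+ 2))))%:E.
Proof.
move=> nX v0 aa bb ab p0.
have [i0 _] : exists i, a i != 0 by apply: dot_gt0_exists; rewrite aa.
have [rho [rho_dot rhoX rho_a _]] := @normal_family_reduction i0 (rem i0 (enum I)) a
  (negbT (mem_rem_uniqF i0 (enum_uniq I))).
pose a1 := rho a; pose b1 := rho b; pose X1 := fun k w => rho (X ^~ w) k.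
have a1_supp k : k != i0 -> a1 k = 0.
  by move=> ki; apply: rho_a; rewrite mem_rem_uniq ?enum_uniq// !inE ki mem_enum.
have a1_sqr : a1 i0 ^+ 2 = v by rewrite expr2 -(dot_supp1 _ a1_supp) rho_dot.
have a1_neq0 : a1 i0 != 0 by rewrite -sqrf_eq0 a1_sqr gt_eqF.
(* Orthogonality survives the rotations, and [a1] is supported on [i0]; thus [b1] lives on the other
   coordinates. *)
have b1_i0 : b1 i0 = 0.
  by apply: (mulfI a1_neq0); rewrite mulr0 -(dot_supp1 _ a1_supp) rho_dot.
have [i1 b1_i1] : exists i, b1 i != 0.
  by apply: dot_gt0_exists; rewrite rho_dot bb.
have i10 : i1 != i0 by apply: contraNneq b1_i1 => ->; rewrite b1_i0.
pose l := rem i0 (rem i1 (enum I)).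
have memr k : (k \in l) = (k != i0) && (k != i1).
  rewrite 2?(mem_rem_uniq, inE) ?rem_uniq ?enum_uniq//.
  by rewrite mem_rem_uniq ?enum_uniq// !inE mem_enum andbT.
have [|rho' [rho'_dot rho'X rho'_b rho'_id]] := @normal_family_reduction i1 l b1.
  by rewrite memr eqxx andbF.
pose b2 := rho' b1; pose X2 := fun k w => rho' (X1 ^~ w) k.
(* The second reduction acts only in the coordinates [i1 :: l], which omit [i0], so it leaves the
   vector already aligned in place. *)
have a2E : rho' a1 = a1.
  by apply: rho'_id => k; rewrite inE memr => /predU1P[->|/andP[k0 _]]; exact: a1_supp.
have b2_i0 : b2 i0 = 0.
  by apply: (mulfI a1_neq0); rewrite mulr0 -(dot_supp1 _ a1_supp) -a2E rho'_dot rho_dot.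
have b2_supp k : k != i1 -> b2 k = 0.
  by have [->//|k0 k1] := eqVneq k i0; apply: rho'_b; rewrite memr k0.
have b2_sqr : b2 i1 ^+ 2 = v.
  by rewrite expr2 -(dot_supp1 _ b2_supp) rho'_dot rho_dot.
have nX2 : normal_family X2 by apply: rho'X; apply: rhoX.
(* Rotating vector and sample together preserves their dot product, so each linear form becomes a
   multiple of one coordinate of [X2]. The sign of the multiple is lost in the squares. *)
have aXE w : dot a (X ^~ w) = a1 i0 * X2 i0 w.
  by rewrite -(dot_supp1 _ a1_supp) -a2E rho'_dot rho_dot.
have bXE w : dot b (X ^~ w) = b2 i1 * X2 i1 w.
  by rewrite -(dot_supp1 _ b2_supp) rho'_dot rho_dot.
pose D := [set z : mR * mR | z.1 ^+ 2 + z.2 ^+ 2 <= p / v].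
have mD : measurable D := measurable_disc (p / v).
rewrite -(normal_probX_disc sigma_gt0); last by rewrite divr_ge0// ltW.
have i01 : i0 != i1 by rewrite eq_sym.
have := normal_family_pair nX2 i01 (fun=> @measurableT _ mR) mD.
rewrite [X in (_ * X)%E]big1 ?mule1; last first.
  by move=> k _; exact: (@probability_setT _ mR _ gamma).
move=> <-; congr (P _); apply/seteqP; split => w /=;
  rewrite /D/= aXE bXE !exprMn a1_sqr b2_sqr -mulrDr ler_pdivlMr// mulrC//.
by case.
Qed.

(** Once [a] is rotated onto an axis, the form is a single normal coordinate times a scalar of
    square [v], and the event is that this coordinate lies in a symmetric interval. *)
Lemma normal_family_dot_itv X a (v p : R) : normal_family X ->
  0 < v -> dot a a = v -> 0 <= p ->
  P [set w | dot a (X ^~ w) ^+ 2 <= p] =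
  (erf (Num.sqrt (p / v / (sigma ^+ 2 *+ 2))))%:E.
Proof.
move=> nX v0 aa p0.
have [i0 _] : exists i, a i != 0 by apply: dot_gt0_exists; rewrite aa.
have [rho [rho_dot rhoX rho_a _]] := @normal_family_reduction i0 (rem i0 (enum I)) a
  (negbT (mem_rem_uniqF i0 (enum_uniq I))).
pose a1 := rho a.
have a1_supp k : k != i0 -> a1 k = 0.
  by move=> ki; apply: rho_a; rewrite mem_rem_uniq ?enum_uniq// !inE ki mem_enum.
have a1_sqr : a1 i0 ^+ 2 = v by rewrite expr2 -(dot_supp1 _ a1_supp) rho_dot.
have pv0 : 0 <= p / v by rewrite divr_ge0// ltW.
rewrite sqrtrM// sqrtrV ?mulrn_wge0 ?sqr_ge0//.
rewrite -(normal_prob_itv_erf sigma_gt0) ?sqrtr_ge0//.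
rewrite -(normal_family_prob (rhoX _ nX) i0)//.
have aX w : (dot a (X ^~ w) ^+ 2 <= p) =
    (rho (X ^~ w) i0 \in `[- Num.sqrt (p / v), Num.sqrt (p / v)]).
  rewrite in_itv/= -ler_norml -sqrtr_sqr ler_sqrt//.
  rewrite -(rho_dot a) (dot_supp1 _ a1_supp) exprMn a1_sqr ler_pdivlMr//.
  by rewrite mulrC.
by congr (P _); apply/seteqP; split => w /=; rewrite aX.
Qed.

End normal_family.

(** * Orthogonality of the sampled cosine and sine *)

Section trigonometric_sums.
Context {R : realType}.
Implicit Types th : R.

(** The sum telescopes: [2 sin th cos(2 n th) = sin((2n+1) th) - sin((2n-1) th)]. *)
Lemma sin_mul_sum_cos th N :
  2 * sin th * (\sum_(n < N) cos (n%:R * (2 * th))) =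
  sin (N%:R * (2 * th) - th) + sin th.
Proof.
elim: N => [|N IH]; first by rewrite big_ord0 mulr0 mul0r sub0r sinN addNr.
rewrite big_ord_recr/= mulrDr IH -[N.+1%:R]natr1.
have -> : (N%:R + 1) * (2 * th) - th = N%:R * (2 * th) + th by ring.
by rewrite sinB sinD; ring.
Qed.

Lemma sin_mul_sum_sin th N :
  2 * sin th * (\sum_(n < N) sin (n%:R * (2 * th))) =
  cos th - cos (N%:R * (2 * th) - th).
Proof.
elim: N => [|N IH]; first by rewrite big_ord0 mulr0 mul0r sub0r cosN subrr.
rewrite big_ord_recr/= mulrDr IH -[N.+1%:R]natr1.
have -> : (N%:R + 1) * (2 * th) - th = N%:R * (2 * th) + th by ring.
by rewrite cosB cosD; ring.
Qed.

(** Double-angle formulas reduce the three sums to those of [cos(2 n th)] and [sin(2 n th)]. These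
    vanish because [N th] is a multiple of [2 pi], while [0 < k < N/2] puts [th] strictly between 0
    and [pi], so that [sin th] can be cancelled. *)
Lemma dft_angle_orthogonality N k : (0 < k)%N -> (k.*2 < N)%N ->
  let th : R := 2 * pi * k%:R / N%:R in
  [/\ \sum_(n < N) cos (n%:R * th) ^+ 2 = N%:R / 2,
      \sum_(n < N) sin (n%:R * th) ^+ 2 = N%:R / 2 &
      \sum_(n < N) cos (n%:R * th) * sin (n%:R * th) = 0].
Proof.
move=> k0 kN th.
have N0 : 0 < N%:R :> R by rewrite ltr0n (leq_trans _ kN).
have th_gt0 : 0 < th by rewrite divr_gt0// !mulr_gt0 ?pi_gt0 ?ltr0n.
have th_ltpi : th < pi.
  rewrite ltr_pdivrMr// mulrAC mulrC ltr_pM2l ?pi_gt0//.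
  by rewrite -natrM mul2n ltr_nat.
have sin0 : 2 * sin th != 0.
  by rewrite mulf_neq0// gt_eqF// sin_gt0_pi// th_gt0.
have Nth : N%:R * (2 * th) - th = - th + (pi *+ 2) *+ (2 * k).
  rewrite addrC; congr (_ + _).
  by rewrite /th -mulrnA -[RHS]mulr_natr !natrM; field; rewrite gt_eqF.
have cos_sum : \sum_(n < N) cos (n%:R * (2 * th)) = 0.
  apply: (mulfI sin0); rewrite mulr0 sin_mul_sum_cos Nth.
  by rewrite (periodicn (@sinD2pi R)) sinN addNr.
have sin_sum : \sum_(n < N) sin (n%:R * (2 * th)) = 0.
  apply: (mulfI sin0); rewrite mulr0 sin_mul_sum_sin Nth.
  by rewrite (periodicn (@cosD2pi R)) cosN subrr.
have dbl (n : nat) : n%:R * (2 * th) = n%:R * th + n%:R * th by ring.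
(* The two sums of squares add up to [N] and have difference 0, so each is [N / 2]. *)
have sumD :
    \sum_(n < N) cos (n%:R * th) ^+ 2 + \sum_(n < N) sin (n%:R * th) ^+ 2 = N%:R.
  rewrite -big_split/=; under eq_bigr do rewrite cos2Dsin2.
  by rewrite sumr_const card_ord.
have sumB :
    \sum_(n < N) cos (n%:R * th) ^+ 2 - \sum_(n < N) sin (n%:R * th) ^+ 2 = 0.
  by rewrite -sumrB -[RHS]cos_sum; apply: eq_bigr => n _; rewrite dbl cosD !expr2.
split; [lra|lra|].
apply: (@mulfI _ (2 : R)) => //; rewrite mulr0 -[RHS]sin_sum mulr_sumr.
by apply: eq_bigr => n _; rewrite dbl sinD; ring.
Qed.

End trigonometric_sums.

(** * The replica power as a quadratic form, and its law *)

Section replica_power.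
Context {R : realType}.

(** The gains are real, so the real and imaginary parts of the transform are linear forms in [g].
    The factor [1/N] is put into the vectors, whose lengths then fix the scale of the law. *)
Lemma gain_replica_powerE N (g : 'I_N -> R) k (th : R := 2 * pi * k%:R / N%:R) :
  gain_replica_power g k =
  dot (fun n : 'I_N => N%:R^-1 * cos (n%:R * th)) g ^+ 2 +
  dot (fun n : 'I_N => N%:R^-1 * - sin (n%:R * th)) g ^+ 2.
Proof.
rewrite /gain_replica_power.
set a := (fun n => _ * cos _); set b := (fun n => _ * - _).
have -> : dft (fun n => (g n)%:C%C) k = (dot a g +i* dot b g)%C.
  rewrite /dft mulr_sumr /dot.
  (* The complex sum and its two real components are accumulated in parallel. *)
  elim/big_rec3: _ => [//|n z y x _ ->].
  rewrite /cexp /= expR0 /a /b.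
  have -> : 2 * pi * (k%:R * n%:R) / N%:R = n%:R * th by rewrite /th; ring.
  rewrite cosN sinN -(rmorph_nat (real_complex R)) -fmorphV/=.
  by apply/eqP; rewrite eq_complex/=; apply/andP; split; apply/eqP; ring.
by rewrite normc_def /= sqr_sqrtr// addr_ge0 ?sqr_ge0.
Qed.

End replica_power.

Theorem mainTheorem6 (R : realType) (d : measure_display)
    (T : measurableType d) (P : probability T R)
    (N : nat) (hN : (2 <= N)%N)
    (sigma : R) (hsigma : 0 < sigma)
    (g : 'I_N -> {RV P >-> R})
    (hg : iid_centered_normal g sigma) :
  forall p : R, 0 <= p ->
    (~~ odd N ->
       P [set w | gain_replica_power (fun n => g n w) N./2 <= p] =
       (erf (Num.sqrt (N%:R * p / (2 * sigma ^+ 2))))%:E) /\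
    (forall k : nat, (0 < k)%N -> (k.*2 < N)%N ->
       P [set w | gain_replica_power (fun n => g n w) k <= p] =
       (1 - expR (- (N%:R * p / sigma ^+ 2)))%:E).
Proof.
move=> p p0; have ng := iid_normal_family hg.
have N0 : 0 < N%:R :> R by rewrite ltr0n (leq_trans _ hN).
have s0 : sigma != 0 by rewrite gt_eqF.
split=> [N_even|k k0 kN].
  (* At the bin [N/2] the angle is [pi]: the sines vanish and the cosines are signs, so a single
     linear form of squared length [N * N^-2 = 1/N] remains. *)
  have th : 2 * pi * (N./2)%:R / N%:R = pi :> R.
    have -> : (N./2)%:R = N%:R / 2 :> R.
      by rewrite -[in RHS](even_halfK N_even) -muln2 natrM mulfK.
    by field; rewrite gt_eqF.
  have npi (n : nat) : n%:R * pi = 0 + pi *+ n :> R by rewrite add0r mulr_natl.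
  pose a (n : 'I_N) : R := N%:R^-1 * cos (n%:R * pi).
  have aa : dot a a = N%:R^-1.
    rewrite /dot; under eq_bigr => n _.
      rewrite /a -expr2 exprMn npi (alternatingn (@cosDpi R)) cos0.
      rewrite mulr1 sqrr_sign mulr1.
      over.
    by rewrite sumr_const card_ord -[LHS]mulr_natr expr2 divfK ?gt_eqF.
  have E w : gain_replica_power (fun n => g n w) N./2 = dot a (fun n => g n w) ^+ 2.
    rewrite gain_replica_powerE th [X in _ + X ^+ 2](_ : _ = 0) ?expr0n ?addr0//.
    rewrite /dot big1// => n _.
    by rewrite npi (alternatingn (@sinDpi R)) sin0 !(mulr0, oppr0, mul0r).
  under eq_set do rewrite E.
  have Ninv_gt0 : 0 < N%:R^-1 :> R by rewrite invr_gt0.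
  apply: etrans (normal_family_dot_itv hsigma ng Ninv_gt0 aa p0) _.
  by congr (erf (Num.sqrt _))%:E; field; rewrite s0 gt_eqF.
have [cc ss cs] := @dft_angle_orthogonality R _ _ k0 kN.
pose th : R := 2 * pi * k%:R / N%:R.
pose a (n : 'I_N) : R := N%:R^-1 * cos (n%:R * th).
pose b (n : 'I_N) : R := N%:R^-1 * - sin (n%:R * th).
(* The squared length is [N^-2 * N/2]; dividing [p] by it cancels the 2 in [2 sigma^2], whence the
   exponent [N p / sigma^2]. *)
have aa : dot a a = (2 * N%:R)^-1.
  rewrite /dot (eq_bigr (fun n : 'I_N => N%:R^-2 * cos (n%:R * th) ^+ 2)).
    by rewrite -mulr_sumr cc; field; rewrite gt_eqF.
  by move=> n _; rewrite -expr2 exprMn exprVn.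
have bb : dot b b = (2 * N%:R)^-1.
  rewrite /dot (eq_bigr (fun n : 'I_N => N%:R^-2 * sin (n%:R * th) ^+ 2)).
    by rewrite -mulr_sumr ss; field; rewrite gt_eqF.
  by move=> n _; rewrite -expr2 exprMn exprVn sqrrN.
have ab : dot a b = 0.
  rewrite /dot (eq_bigr (fun n : 'I_N =>
    - N%:R^-2 * (cos (n%:R * th) * sin (n%:R * th)))).
    by rewrite -mulr_sumr cs mulr0.
  by move=> n _; rewrite /a /b -exprVn; ring.
under eq_set do rewrite gain_replica_powerE.
have v_gt0 : 0 < (2 * N%:R)^-1 :> R by rewrite invr_gt0 mulr_gt0.
apply: etrans (normal_family_dot2_disc hsigma ng v_gt0 aa bb ab p0) _.
by congr (1 - expR (- _))%:E; field; rewrite s0 gt_eqF.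
Qed.
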